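(* Let $\Omega$ be a topological space, let $T_1,\dots,T_\gamma:\Omega\to\Omega$ be commuting homeomorphisms, write $T^n=T_1^{n_1}\cdots T_\gamma^{n_\gamma}$ for $n\in\mathbb{Z}^\gamma$, and assume the $\mathbb{Z}^\gamma$-action $n\mapsto T^n$ is minimal. Let $f:\Omega\to\mathbb{R}$ be continuous and for $\omega\in\Omega$ define $H_\omega$ on $\ell^2(\mathbb{Z}^\gamma)$ by $(H_\omega u)(n)=\sum_{|m-n|=1}u(m)+f(T^n\omega)u(n)$. If $H_{\omega}$ has uniformly localized eigenfunctions (ULE) for a single $\omega\in\Omega$, then $H_\omega$ has homogeneous ULE in $\Omega$: there exist $\alpha>0$, $C>0$ independent of $\omega$ such that for every $\omega\in\Omega$, $H_\omega$ has a complete orthonormal set of eigenfunctions $\{\phi^\omega_n\}$ and points $m^\omega_n\in\mathbb{Z}^\gamma$ with $|\phi^\omega_n(m)|\le Ce^{-\alpha|m-m^\omega_n|}$ for all $n,m$.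
   Context: Minimal means every orbit $\{T^n\omega:n\in\mathbb{Z}^\gamma\}$ is dense in $\Omega$. $|\cdot|$ denotes the norm on $\mathbb{Z}^\gamma$. A self-adjoint operator $H$ on $\ell^2(\mathbb{Z}^\gamma)$ has ULE if it has a complete orthonormal set of eigenfunctions $\{\phi_n\}$ and there exist $\alpha>0$, $C>0$ and points $m_n\in\mathbb{Z}^\gamma$ such that $|\phi_n(m)|\le Ce^{-\alpha|m-m_n|}$ for all $n,m$. *)

(* Defs.v *)
From HB Require Import structures.
From mathcomp Require Import all_boot all_order all_algebra.
From mathcomp Require Import all_classical all_reals all_analysis.
From mathcomp Require Import complex.
Set Implicit Arguments. Unset Strict Implicit. Unset Printing Implicit Defensive.
Import Order.TTheory GRing.Theory Num.Theory.
Import numFieldNormedType.Exports.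
Local Open Scope classical_set_scope.
Local Open Scope ring_scope.

Definition site (g : nat) := {ffun 'I_g -> int}.

Definition znorm g (m : site g) : int := \sum_(i < g) `|m i|.
Definition zdist g (m n : site g) : int := znorm [ffun i => m i - n i].

Definition powZ (X : Type) (f finv : X -> X) (k : int) : X -> X :=
  match k with
  | Posz n => iter n f
  | Negz n => iter n.+1 finv
  end.

Definition Tpow g (X : Type) (T Tinv : 'I_g -> X -> X) (n : site g) : X -> X :=
  foldr (fun i h => powZ (T i) (Tinv i) (n i) \o h) id (enum 'I_g).

Definition minimal_action g (X : topologicalType) (T Tinv : 'I_g -> X -> X) :=
  forall w : X, closure (range (fun n => Tpow T Tinv n w)) = setT.

Definition shift g (n : site g) (i : 'I_g) (s : int) : site g :=
  [ffun j => if j == i then n j + s else n j].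

(* (H_w u)(n) = sum_{|m-n|=1} u(m) + f(T^n w) u(n); with the l^1 norm the
   sites m with |m - n| = 1 are exactly the 2g sites n +/- e_i. *)
Definition Hop g (X : Type) (R : realType) (T Tinv : 'I_g -> X -> X)
  (f : X -> R) (w : X) (u : site g -> complex R) : site g -> complex R :=
  fun n => \sum_(i < g) (u (shift n i 1) + u (shift n i (-1)))
           + ((f (Tpow T Tinv n w))%:C)%C * u n.

(* Sum of an absolutely summable real family (positive minus negative part). *)
Definition rsum (T : choiceType) (R : realType) (h : T -> R) : R :=
  fine (\esum_(x in [set: T]) (Num.max (h x) 0)%:E)
  - fine (\esum_(x in [set: T]) (Num.max (- h x) 0)%:E).

Definition l2 g (R : realType) (u : site g -> complex R) : Prop :=
  (\esum_(m in [set: site g]) ((Normc.normc (u m)) ^+ 2)%:E < +oo)%E.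

Definition inner g (R : realType) (u v : site g -> complex R) : complex R :=
  let z := fun m => u m * conjc (v m) in
  (rsum (fun m => complex.Re (z m)) +i* rsum (fun m => complex.Im (z m)))%C.

Definition ULE_with g (R : realType) (H : (site g -> complex R) -> site g -> complex R)
  (a C : R) : Prop :=
  exists (I : Type) (phi : I -> site g -> complex R) (c : I -> site g),
    (forall k, l2 (phi k)) /\
    (forall k, exists E : complex R, forall m, H (phi k) m = E * phi k m) /\
    (forall k, inner (phi k) (phi k) = 1) /\
    (forall k l, k <> l -> inner (phi k) (phi l) = 0) /\
    (forall u, l2 u -> (forall k, inner u (phi k) = 0) -> u = (fun _ => 0)) /\
    (forall k m, Normc.normc (phi k m) <= C * expR (- a * (zdist m (c k))%:~R)).

Definition ULE g (R : realType) (H : (site g -> complex R) -> site g -> complex R) : Prop :=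
  exists a C : R, 0 < a /\ 0 < C /\ ULE_with H a C.

(* Main.v *)
(** If [H_{w0}] has ULE with constants [a, C], then so has every translate of
    it, with the same constants, and [T^n w0] converges to any given [w] along
    some ultrafilter.  Index the eigenfunctions by their centre [x] and a label
    [i < K]: uniform decay bounds the number [K] of eigenfunctions with a common
    centre.  For fixed [(x, i)] the translated eigenfunctions converge pointwise
    along the ultrafilter, and uniform exponential decay allows dominated
    convergence: Gram matrix, eigenvalue equation and the Parseval identities
    [sum_(x, i) |psi_(x, i)(m)|^2 = 1] pass to the limit.  The last ones say that
    every [delta_m] lies in the closed span, so the limit system is complete; no
    spectral theory is involved and [f] may be unbounded. *)

Require Import Defs.
From HB Require Import structures.
From mathcomp Require Import all_boot all_order all_algebra.
From mathcomp Require Import all_classical all_reals all_analysis.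
From mathcomp Require Import complex ring lra.
Import Order.TTheory GRing.Theory Num.Theory.
Import numFieldNormedType.Exports.
Local Open Scope classical_set_scope.
Local Open Scope ring_scope.

Set Implicit Arguments.
Unset Strict Implicit.
Unset Printing Implicit Defensive.

Local Notation normc := Normc.normc.

(** * Unordered sums and dominated convergence *)

Lemma cvg_norm_le (R : realType) (N : Type) (F : set_system N) (FF : ProperFilter F)
    (f : N -> R) (l c : R) :
  f n @[n --> F] --> l -> (\forall n \near F, `|f n| <= c) -> `|l| <= c.
Proof.
move=> fl fc; have cn := cvg_norm fl.
rewrite -(cvg_lim _ (cn _)) //; apply: limr_le => //.
by apply/cvg_ex; exists `|l|; exact: cn.
Qed.

Section UnorderedSums.
Variables (T : choiceType) (R : realType).
Implicit Types (h : T -> R) (s t : seq T).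

(* Finite subsets, ordered by inclusion, are represented by duplicate-free lists. *)
Definition above : set_system (seq T) :=
  filter_from [set: seq T] (fun s0 => [set s | uniq s /\ {subset s0 <= s}]).

Lemma above_uniq s0 : above [set s | uniq s /\ {subset s0 <= s}].
Proof. by exists s0. Qed.

Global Instance above_filter : ProperFilter above.
Proof.
apply: filter_from_proper; last first.
  by move=> s _; exists (undup s); split; [exact: undup_uniq | move=> x; rewrite mem_undup].
apply: filter_from_filter; first by exists [::].
move=> s t _ _; exists (s ++ t) => // r [ur sr].
by split; split=> // x xs; apply: sr; rewrite mem_cat xs ?orbT.
Qed.

(** Absolute summability is a bound on all finite sums, so that comparison, addition and scaling
    stay finite arithmetic. *)
Definition summ h := exists M, forall s, uniq s -> \sum_(x <- s) `|h x| <= M.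

(** The common part is listed as a filter of [t]: it collapses to [t] itself as soon as [t] is
    contained in [s]. *)
Lemma sum_split_mem (h : T -> R) s t : uniq s -> uniq t ->
  \sum_(x <- s) h x =
  \sum_(x <- [seq x <- t | x \in s]) h x + \sum_(x <- [seq x <- s | x \notin t]) h x.
Proof.
move=> us ut.
rewrite (bigID (mem t)) /=; congr (_ + _); last by rewrite big_filter.
rewrite -big_filter.
apply: perm_big; apply: uniq_perm; rewrite ?filter_uniq // => x.
by rewrite !mem_filter andbC.
Qed.

Lemma sum_subset_ge0 (h : T -> R) s t : (forall x, 0 <= h x) ->
  uniq s -> uniq t -> {subset s <= t} -> \sum_(x <- s) h x <= \sum_(x <- t) h x.
Proof.
move=> h0 us ut st; rewrite (sum_split_mem h ut us).
rewrite (_ : [seq x <- s | x \in t] = s) ?lerDl ?sumr_ge0 //.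
by apply/all_filterP/allP => x /st.
Qed.

(** Take [s0] whose sum is within [e] of the supremum of all finite sums; appending a disjoint list
    to [s0] cannot exceed that supremum. *)
Lemma summ_tail h : summ h -> forall e, 0 < e -> exists2 s0, uniq s0 &
  forall s, uniq s -> (forall x, x \in s -> x \notin s0) -> \sum_(x <- s) `|h x| <= e.
Proof.
move=> [M hM] e e0.
pose A := [set r | exists2 s, uniq s & r = \sum_(x <- s) `|h x|].
have supA : has_sup A.
  split; first by exists 0; exists [::]; rewrite ?big_nil.
  by exists M => _ [s us ->]; exact: hM.
have [_ [s0 us0 ->] lt0] := sup_adherent e0 supA.
exists s0 => // s us dis.
have us' : uniq (s0 ++ s).
  by rewrite cat_uniq us0 us andbT /=; apply/hasPn => x /dis.
have : \sum_(x <- s0 ++ s) `|h x| <= sup A.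
  by apply: (sup_upper_bound supA); exists (s0 ++ s).
by rewrite big_cat /=; move: lt0; lra.
Qed.

Lemma esum_sup_ge (a : T -> R) s : (forall x, 0 <= a x) -> uniq s ->
  ((\sum_(x <- s) a x)%:E <= \esum_(x in [set: T]) (a x)%:E)%E.
Proof.
move=> a0 us; apply: esum_ge; exists [set` s]; first by split=> //; exact: finite_seq.
by rewrite -fsbig_seq // sumEFin.
Qed.

Lemma esum_le_bound (a : T -> R) M :
  (forall s, uniq s -> \sum_(x <- s) a x <= M) ->
  (\esum_(x in [set: T]) (a x)%:E <= M%:E)%E.
Proof.
move=> hM; apply: ge_ereal_sup => _ [A [fA _] <-].
by rewrite fsbig_finite //= sumEFin lee_fin hM.
Qed.

Lemma esum_fin (a : T -> R) : (forall x, 0 <= a x) -> summ a ->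
  (\esum_(x in [set: T]) (a x)%:E \is a fin_num)%E.
Proof.
move=> a0 [M hM]; rewrite ge0_fin_numE; last by apply: esum_ge0 => x _; rewrite lee_fin.
apply: le_lt_trans (ltry M); apply: esum_le_bound => s us.
by apply: le_trans (hM s us); apply: ler_sum => x _; exact: ler_norm.
Qed.

Lemma esum_cvg (a : T -> R) : (forall x, 0 <= a x) -> summ a ->
  (fun s => \sum_(x <- s) a x) @ above --> fine (\esum_(x in [set: T]) (a x)%:E).
Proof.
move=> a0 sa; have fe := esum_fin a0 sa.
set S := fine _; have SE : S%:E = (\esum_(x in [set: T]) (a x)%:E)%E by rewrite /S fineK.
have le_S s : uniq s -> \sum_(x <- s) a x <= S.
  by move=> us; rewrite -lee_fin SE; exact: esum_sup_ge.
apply/cvgrPdist_lt => e e0.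
have [s0 us0 hs0] : exists2 s0, uniq s0 & S - e < \sum_(x <- s0) a x.
  apply: contrapT => hN.
  have : (\esum_(x in [set: T]) (a x)%:E <= (S - e)%:E)%E.
    apply: esum_le_bound => s us; rewrite leNgt; apply/negP => hs.
    by apply: hN; exists s.
  by rewrite -SE lee_fin; lra.
apply: (filterS _ (above_uniq s0)) => s [us ss].
move: (sum_subset_ge0 a0 us0 us ss) (le_S s us) => l1 l2.
by rewrite ger0_norm ?subr_ge0 //=; lra.
Qed.

Lemma summ_le h k : (forall x, `|h x| <= `|k x|) -> summ k -> summ h.
Proof.
move=> hk [M hM]; exists M => s us; apply: le_trans (hM s us).
by apply: ler_sum => x _.
Qed.

Lemma summD h k : summ h -> summ k -> summ (fun x => h x + k x).
Proof.
move=> [M hM] [N kN]; exists (M + N) => s us.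
apply: le_trans (lerD (hM s us) (kN s us)); rewrite -big_split /=.
by apply: ler_sum => x _; exact: ler_normD.
Qed.

Lemma summZ h c : summ h -> summ (fun x => c * h x).
Proof.
move=> [M hM]; exists (`|c| * M) => s us.
under eq_bigr do rewrite normrM.
by rewrite -mulr_sumr ler_wpM2l // hM.
Qed.

(** Recasts [rsum], defined through positive and negative parts, as a limit over finite sets; rules
    for sums then follow from rules for limits. *)
Lemma rsum_cvg h : summ h -> (fun s => \sum_(x <- s) h x) @ above --> rsum h.
Proof.
move=> sh.
have pos (k : T -> R) : summ k ->
    (fun s => \sum_(x <- s) Num.max (k x) 0) @ above -->
    fine (\esum_(x in [set: T]) (Num.max (k x) 0)%:E).
  move=> sk; apply: esum_cvg; first by move=> x; rewrite le_max lexx orbT.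
  apply: summ_le sk => x; rewrite ger0_norm ?le_max ?lexx ?orbT //.
  by rewrite ge_max ler_norm normr_ge0.
have shN : summ (fun x => - h x).
  by apply: summ_le sh => x; rewrite normrN.
have -> : (fun s => \sum_(x <- s) h x) =
    (fun s => \sum_(x <- s) Num.max (h x) 0) -
    (fun s => \sum_(x <- s) Num.max (- h x) 0).
  apply/funext => s; rewrite /= !fctE -sumrB; apply: eq_bigr => x _.
  by rewrite !maxEle; case: ifPn; case: ifPn; lra.
exact: cvgB (pos _ sh) (pos _ shN).
Qed.

Lemma rsum_tail h (k : T -> R) s0 (e : R) : summ h ->
  (forall x, `|h x| <= k x) ->
  uniq s0 ->
  (forall s, uniq s -> (forall x, x \in s -> x \notin s0) -> \sum_(x <- s) k x <= e) ->
  `|rsum h - \sum_(x <- s0) h x| <= e.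
Proof.
move=> sh hk us0 tl.
have c : (fun s => \sum_(x <- s) h x - \sum_(x <- s0) h x) @ above -->
    rsum h - \sum_(x <- s0) h x by apply: cvgB (rsum_cvg sh) (cvg_cst _).
apply: (cvg_norm_le _ c); apply: (filterS _ (above_uniq s0)) => s [us ss].
rewrite (sum_split_mem h us us0).
have -> : [seq x <- s0 | x \in s] = s0 by apply/all_filterP/allP => x /ss.
rewrite addrAC subrr add0r.
apply: le_trans (ler_norm_sum _ _ _) _.
apply: le_trans (tl [seq x <- s | x \notin s0] _ _).
- by apply: ler_sum => x _.
- by rewrite filter_uniq.
- by move=> x; rewrite mem_filter => /andP[].
Qed.

(** One finite set outside which [k] has a small sum controls the tails of [h0] and of all [h n] at
    once, and the remaining finite sum converges termwise. [F] is any proper filter, since limits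
    are later taken along ultrafilters. *)
Lemma rsum_dominated (N : Type) (F : set_system N) (FF : ProperFilter F)
    (h : N -> T -> R) (h0 k : T -> R) :
  summ k -> (forall n x, `|h n x| <= k x) ->
  (forall x, h n x @[n --> F] --> h0 x) ->
  rsum (h n) @[n --> F] --> rsum h0.
Proof.
move=> sk hk hc.
have k0 x : 0 <= k x.
  have [n _] := filter_ex (@filterT _ F _); exact: le_trans (normr_ge0 _) (hk n x).
have hk0 x : `|h0 x| <= k x.
  by apply: (cvg_norm_le _ (hc x)); apply: filterE => n; exact: hk.
have sh n : summ (h n) by apply: summ_le sk => x; rewrite (ger0_norm (k0 x)) hk.
have sh0 : summ h0 by apply: summ_le sk => x; rewrite (ger0_norm (k0 x)) hk0.
apply/cvgrPdist_lt => e e0.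
(* Two tails and one finite difference, each at most [e / 4], stay below [e]. *)
have e4 : 0 < e / 4 by lra.
have [s0 us0 tl] := summ_tail sk e4.
have tl' s : uniq s -> (forall x, x \in s -> x \notin s0) -> \sum_(x <- s) k x <= e / 4.
  by move=> us d; apply: le_trans (tl s us d); apply: ler_sum => x _; exact: ler_norm.
have cs : \sum_(x <- s0) h n x @[n --> F] --> \sum_(x <- s0) h0 x.
  by apply: cvg_big => [|x _]; [exact: add_continuous|exact: hc].
have /cvgrPdist_lt/(_ _ e4) := cs; apply: filterS => n hn.
have t1 := rsum_tail (sh n) (hk n) us0 tl'.
have t2 := rsum_tail sh0 hk0 us0 tl'.
have -> : rsum h0 - rsum (h n) = (rsum h0 - \sum_(x <- s0) h0 x)
   + (\sum_(x <- s0) h0 x - \sum_(x <- s0) h n x) - (rsum (h n) - \sum_(x <- s0) h n x) by lra.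
apply: le_lt_trans (ler_normB _ _) _.
by have := ler_normD (rsum h0 - \sum_(x <- s0) h0 x) (\sum_(x <- s0) h0 x - \sum_(x <- s0) h n x); lra.
Qed.

End UnorderedSums.

(** * Complex-valued limits and sums *)

Section ComplexLimits.
Variable R : realType.
Implicit Types z w : R[i].

Lemma ReD z w : complex.Re (z + w) = complex.Re z + complex.Re w.
Proof. by case: z w => a b []. Qed.

Lemma ImD z w : complex.Im (z + w) = complex.Im z + complex.Im w.
Proof. by case: z w => a b []. Qed.

Lemma ReM z w :
  complex.Re (z * w) = complex.Re z * complex.Re w - complex.Im z * complex.Im w.
Proof. by case: z w => a b []. Qed.

Lemma ImM z w :
  complex.Im (z * w) = complex.Re z * complex.Im w + complex.Im z * complex.Re w.
Proof. by case: z w => a b []. Qed.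

Lemma complex_ext z w :
  complex.Re z = complex.Re w -> complex.Im z = complex.Im w -> z = w.
Proof. by case: z w => a b [c d] /= -> ->. Qed.

Lemma normc_sqr z : normc z ^+ 2 = complex.Re z ^+ 2 + complex.Im z ^+ 2.
Proof. by case: z => a b /=; rewrite sqr_sqrtr // addr_ge0 ?sqr_ge0. Qed.

Lemma normc_ge0 z : 0 <= normc z.
Proof. by case: z => a b; exact: sqrtr_ge0. Qed.

Lemma Re_le_normc z : `|complex.Re z| <= normc z.
Proof.
rewrite -(@ler_pXn2r _ 2) ?nnegrE ?normc_ge0 //.
by rewrite normc_sqr real_normK ?num_real // lerDl sqr_ge0.
Qed.

Lemma Im_le_normc z : `|complex.Im z| <= normc z.
Proof.
rewrite -(@ler_pXn2r _ 2) ?nnegrE ?normc_ge0 //.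
by rewrite normc_sqr real_normK ?num_real // lerDr sqr_ge0.
Qed.

Lemma normc_conj z : normc (conjc z) = normc z.
Proof. by case: z => a b /=; rewrite sqrrN. Qed.

Lemma normc_sum (I : Type) (s : seq I) (z : I -> R[i]) :
  normc (\sum_(i <- s) z i) <= \sum_(i <- s) normc (z i).
Proof.
elim/big_rec2: _ => [|i a b _ h]; first by rewrite Normc.normc0.
by apply: le_trans (le_normcD _ _) _; rewrite lerD2l.
Qed.

Lemma mulr_conjc z : z * conjc z = ((normc z ^+ 2)%:C)%C.
Proof. by rewrite normc_sqr; case: z => a b /=; simpc; congr (_ +i* _)%C; ring. Qed.

Section Filter.
Variables (N : Type) (F : set_system N).
Context {FF : ProperFilter F}.
Implicit Types (u v : N -> R[i]).

(** Stated on coordinates to match [inner], which is built from real sums of real and imaginary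
    parts. *)
Definition ccvg u (l : R[i]) :=
  (complex.Re (u n) @[n --> F] --> complex.Re l) /\
  (complex.Im (u n) @[n --> F] --> complex.Im l).

Lemma ccvg_cst z : ccvg (fun=> z) z.
Proof. by split; exact: cvg_cst. Qed.

Lemma ccvg_real (a : N -> R) (l : R) :
  a n @[n --> F] --> l -> ccvg (fun n => ((a n)%:C)%C) (l%:C)%C.
Proof. by move=> h; split=> //=; exact: cvg_cst. Qed.

Lemma ccvgD u v a b : ccvg u a -> ccvg v b -> ccvg (fun n => u n + v n) (a + b).
Proof.
move=> [u1 u2] [v1 v2]; split.
  by rewrite ReD (_ : (fun _ => _) = (fun n => complex.Re (u n) + complex.Re (v n)));
    [exact: cvgD | apply/funext => n; rewrite ReD].
by rewrite ImD (_ : (fun _ => _) = (fun n => complex.Im (u n) + complex.Im (v n)));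
  [exact: cvgD | apply/funext => n; rewrite ImD].
Qed.

Lemma ccvgM u v a b : ccvg u a -> ccvg v b -> ccvg (fun n => u n * v n) (a * b).
Proof.
move=> [u1 u2] [v1 v2]; split.
  rewrite ReM (_ : (fun _ => _) = (fun n => complex.Re (u n) * complex.Re (v n)
    - complex.Im (u n) * complex.Im (v n))); last by apply/funext => n; rewrite ReM.
  by apply: cvgB; exact: cvgM.
rewrite ImM (_ : (fun _ => _) = (fun n => complex.Re (u n) * complex.Im (v n)
    + complex.Im (u n) * complex.Re (v n))); last by apply/funext => n; rewrite ImM.
by apply: cvgD; exact: cvgM.
Qed.

Lemma ccvg_conj u a : ccvg u a -> ccvg (fun n => conjc (u n)) (conjc a).
Proof.
have ReJ z : complex.Re (conjc z) = complex.Re z by case: z.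
have ImJ z : complex.Im (conjc z) = - complex.Im z by case: z.
move=> [u1 u2]; split.
  by rewrite ReJ (_ : (fun _ => _) = (fun n => complex.Re (u n))) //; apply/funext => n.
rewrite ImJ (_ : (fun _ => _) = (fun n => - complex.Im (u n))); first exact: cvgN.
by apply/funext => n; rewrite ImJ.
Qed.

Lemma ccvg_sum (I : Type) (s : seq I) (u : I -> N -> R[i]) (a : I -> R[i]) :
  (forall i, ccvg (u i) (a i)) -> ccvg (fun n => \sum_(i <- s) u i n) (\sum_(i <- s) a i).
Proof.
move=> h; elim: s => [|i s IH].
  by rewrite big_nil (_ : (fun _ => _) = fun=> 0);
    [exact: ccvg_cst | apply/funext => n; rewrite big_nil].
rewrite big_cons (_ : (fun _ => _) = fun n => u i n + \sum_(j <- s) u j n);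
  last by apply/funext => n; rewrite big_cons.
exact: ccvgD.
Qed.

Lemma ccvg_unique u a b : ccvg u a -> ccvg u b -> a = b.
Proof.
by move=> [a1 a2] [b1 b2]; apply: complex_ext; [exact: (cvg_unique _ a1 b1)|exact: (cvg_unique _ a2 b2)].
Qed.

Lemma ccvg_near_cst u a b : ccvg u a -> (\forall n \near F, u n = b) -> a = b.
Proof.
move=> ua ub; apply: ccvg_unique ua _; split.
  by apply: cvg_near_cst; apply: filterS ub => n ->.
by apply: cvg_near_cst; apply: filterS ub => n ->.
Qed.

(** The squared modulus is a polynomial in the coordinates; bounds on the modulus pass to the limit
    through it. *)
Lemma ccvg_normc2 u a : ccvg u a -> normc (u n) ^+ 2 @[n --> F] --> normc a ^+ 2.
Proof.
move=> [u1 u2]; rewrite normc_sqr (_ : (fun _ => _) =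
  (fun n => complex.Re (u n) ^+ 2 + complex.Im (u n) ^+ 2)).
  by apply: cvgD; rewrite /= expr2; apply: cvgM.
by apply/funext => n; rewrite normc_sqr.
Qed.

Lemma ccvg_normc_le u a c : ccvg u a -> (forall n, normc (u n) <= c) -> normc a <= c.
Proof.
move=> ua uc.
have c0 : 0 <= c.
  by have [n _] := filter_ex (@filterT _ F _); exact: le_trans (normc_ge0 _) (uc n).
rewrite -(@ler_pXn2r _ 2) ?nnegrE ?normc_ge0 //.
rewrite -[normc a ^+ 2]ger0_norm ?sqr_ge0 //.
apply: (cvg_norm_le _ (ccvg_normc2 ua)); apply: filterE => n.
by rewrite ger0_norm ?sqr_ge0 // ler_pXn2r ?nnegrE ?normc_ge0.
Qed.

End Filter.

(** The image of an ultrafilter is an ultrafilter, and on the compact segment from [- c] to [c]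
    every ultrafilter converges. *)
Lemma ultra_bounded_cvg (N : Type) (U : set_system N) (UU : UltraFilter U)
  (a : N -> R) (c : R) : (forall n, `|a n| <= c) -> exists l : R, a n @[n --> U] --> l.
Proof.
move=> ac.
have := @segment_compact R (- c) c; rewrite compact_ultra => /(_ (fmap a U)) [].
- split; first exact: fmap_proper_filter.
  move=> G GF sG; apply/seteqP; split => // A GA.
  have [//|UA] := in_ultra_setVsetC (a @^-1` A) UU.
  have : G (~` A) by apply: sG.
  move=> GnA; exfalso; apply: (@filter_not_empty _ G GF).
  by rewrite -(setICr A); exact: filterI.
- by rewrite /fmap /=; apply: filterE => n /=; rewrite in_itv /= -ler_norml; exact: ac.
- by move=> l [_ hl]; exists l.
Qed.

Lemma ultra_bounded_ccvg (N : Type) (U : set_system N) (UU : UltraFilter U)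
  (u : N -> R[i]) (c : R) : (forall n, normc (u n) <= c) -> exists l, ccvg U u l.
Proof.
move=> uc.
have [a ha] := @ultra_bounded_cvg _ U _ (fun n => complex.Re (u n)) c
  (fun n => le_trans (Re_le_normc _) (uc n)).
have [b hb] := @ultra_bounded_cvg _ U _ (fun n => complex.Im (u n)) c
  (fun n => le_trans (Im_le_normc _) (uc n)).
by exists (a +i* b)%C.
Qed.

End ComplexLimits.

Section ComplexSums.
Variables (R : realType) (T : choiceType).
Implicit Types (z w : T -> R[i]).

(** The same two real sums as in [inner], so that [innerE] is a conversion. *)
Definition csum z : R[i] :=
  (rsum (fun m => complex.Re (z m)) +i* rsum (fun m => complex.Im (z m)))%C.

Definition summc z := summ (fun x => normc (z x)).

Lemma summc_le z (k : T -> R) : (forall x, normc (z x) <= k x) -> summ k -> summc z.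
Proof.
move=> zk; apply: summ_le => x; rewrite ger0_norm ?normc_ge0 //.
exact: le_trans (zk x) (ler_norm _).
Qed.

Lemma summc_Re z : summc z -> summ (fun x => complex.Re (z x)).
Proof. by apply: summ_le => x; rewrite (ger0_norm (normc_ge0 _)) Re_le_normc. Qed.

Lemma summc_Im z : summc z -> summ (fun x => complex.Im (z x)).
Proof. by apply: summ_le => x; rewrite (ger0_norm (normc_ge0 _)) Im_le_normc. Qed.

Lemma Re_sum (s : seq T) z :
  complex.Re (\sum_(x <- s) z x) = \sum_(x <- s) complex.Re (z x).
Proof. by elim/big_rec2: _ => //= x a b _ <-; rewrite ReD. Qed.

Lemma Im_sum (s : seq T) z :
  complex.Im (\sum_(x <- s) z x) = \sum_(x <- s) complex.Im (z x).
Proof. by elim/big_rec2: _ => //= x a b _ <-; rewrite ImD. Qed.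

Lemma csum_ccvg z : summc z -> ccvg (@above T) (fun s => \sum_(x <- s) z x) (csum z).
Proof.
move=> sz; split.
  under eq_fun do rewrite Re_sum.
  exact: rsum_cvg (summc_Re sz).
under eq_fun do rewrite Im_sum.
exact: rsum_cvg (summc_Im sz).
Qed.

Lemma csum_eq z l : summc z -> ccvg (@above T) (fun s => \sum_(x <- s) z x) l -> csum z = l.
Proof. by move=> sz; exact: ccvg_unique (csum_ccvg sz). Qed.

Lemma summcD z w : summc z -> summc w -> summc (fun x => z x + w x).
Proof. by move=> sz sw; apply: summc_le (summD sz sw) => x; exact: le_normcD. Qed.

Lemma summcZ c z : summc z -> summc (fun x => c * z x).
Proof.
by move=> sz; apply: summc_le (summZ (normc c) sz) => x; rewrite Normc.normcM.
Qed.

Lemma csumD z w : summc z -> summc w -> csum (fun x => z x + w x) = csum z + csum w.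
Proof.
move=> sz sw; apply: csum_eq; first exact: summcD.
under eq_fun do rewrite big_split.
exact: ccvgD (csum_ccvg sz) (csum_ccvg sw).
Qed.

Lemma csumZ c z : summc z -> csum (fun x => c * z x) = c * csum z.
Proof.
move=> sz; apply: csum_eq; first exact: summcZ.
under eq_fun do rewrite -mulr_sumr.
by apply: ccvgM; [exact: ccvg_cst | exact: csum_ccvg].
Qed.

Lemma csum_conj z : summc z -> csum (fun x => conjc (z x)) = conjc (csum z).
Proof.
move=> sz; apply: csum_eq; first by apply: summc_le sz => x; rewrite normc_conj.
under eq_fun do rewrite -rmorph_sum.
exact: ccvg_conj (csum_ccvg sz).
Qed.

Lemma csum_dominated (N : Type) (F : set_system N) (FF : ProperFilter F)
    (z : N -> T -> R[i]) (z0 : T -> R[i]) (k : T -> R) :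
  summ k -> (forall n x, normc (z n x) <= k x) ->
  (forall x, ccvg F (fun n => z n x) (z0 x)) ->
  ccvg F (fun n => csum (z n)) (csum z0).
Proof.
move=> sk zk zc; split; apply: (rsum_dominated _ sk).
- by move=> n x; exact: le_trans (Re_le_normc _) (zk n x).
- by move=> x; case: (zc x).
- by move=> n x; exact: le_trans (Im_le_normc _) (zk n x).
- by move=> x; case: (zc x).
Qed.

Lemma csum_delta (m : T) (z : T -> R[i]) :
  csum (fun x => if x == m then z x else 0) = z m.
Proof.
have sz : summc (fun x => if x == m then z x else 0).
  exists (normc (z m)) => s us.
  have [ms|ms] := boolP (m \in s).
    rewrite (bigD1_seq m) //= eqxx big1 ?addr0 ?ger0_norm ?normc_ge0 // => i /negPf ->.
    by rewrite Normc.normc0 normr0.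
  rewrite big_seq big1 ?normc_ge0 // => i si.
  by case: eqP => [im|_]; [rewrite -im si in ms | rewrite Normc.normc0 normr0].
apply: (ccvg_near_cst (csum_ccvg sz)).
apply: (filterS _ (above_uniq [:: m])) => s [us /(_ m)].
rewrite inE eqxx => /(_ isT) ms.
by rewrite (bigD1_seq m) //= eqxx big1 ?addr0 // => i /negPf ->.
Qed.

End ComplexSums.

(** * Exponential weights on the lattice *)

Section Sites.
Variable g : nat.
Implicit Types m n c : site g.

Lemma zdistE m c : zdist m c = znorm (m - c).
Proof. by rewrite /zdist; congr znorm; apply/ffunP => i; rewrite !ffunE. Qed.

Lemma znorm_ge0 m : 0 <= znorm m.
Proof. by apply: sumr_ge0 => i _. Qed.

Lemma znormD m n : znorm (m + n) <= znorm m + znorm n.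
Proof. by rewrite -big_split; apply: ler_sum => i _; rewrite ffunE ler_normD. Qed.

Lemma zdistC m n : zdist m n = zdist n m.
Proof. by apply: eq_bigr => i _; rewrite !ffunE distrC. Qed.

Lemma zdist_triangle c m n : zdist m n <= zdist m c + zdist c n.
Proof. by rewrite !zdistE -[m - n](subrKA c) znormD. Qed.

Lemma zdistD2r k m n : zdist (m + k) (n + k) = zdist m n.
Proof. by rewrite !zdistE opprD addrACA subrr addr0. Qed.

Variable R : realType.

Lemma geometric_sum_le (q : R) (N : nat) : 0 <= q -> q < 1 ->
  \sum_(k < N) q ^+ k <= (1 - q)^-1.
Proof.
move=> q0 q1; rewrite -div1r ler_pdivlMr ?subr_gt0 //.
have := subrX1 q N; have := exprn_ge0 N q0; set S := \sum_(_ < _) _; lra.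
Qed.

Definition expd (a : R) (c m : site g) : R := expR (- a * (zdist m c)%:~R).

Lemma expd_gt0 a c m : 0 < expd a c m.
Proof. exact: expR_gt0. Qed.

Lemma expd_le1 (a : R) c m : 0 < a -> expd a c m <= 1.
Proof.
move=> a0; rewrite /expd -[leRHS]expR0 ler_expR mulNr oppr_le0 mulr_ge0 ?(ltW a0) //.
by rewrite ler0z zdistE znorm_ge0.
Qed.

(** The l^1 norm turns the exponential weight into a product over coordinates, which is what lets
    its lattice sum factor. *)
Lemma znorm_exp_prod (a : R) m :
  expR (- a * (znorm m)%:~R) = \prod_(i < g) expR (- a) ^+ `|m i|%N.
Proof.
rewrite /znorm rmorph_sum mulr_sumr expR_sum; apply: eq_bigr => i _.
by rewrite -expRM_natr natr_absz.
Qed.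

(* The full sum factors into [g] two-sided geometric series, each bounded by
   [2 / (1 - exp (- a))]. *)
Lemma expd_sum_le a : 0 < a -> exists2 L, 0 <= L &
  forall c s, uniq s -> \sum_(x <- s) expd a c x <= L.
Proof.
move=> a0; set q := expR (- a).
have q0 : 0 <= q := expR_ge0 _.
have q1 : q < 1 by rewrite /q expR_lt1 oppr_lt0.
exists ((2 * (1 - q)^-1) ^+ g); first by rewrite exprn_ge0 ?mulr_ge0 ?invr_ge0 ?subr_ge0 1?ltW.
move=> c s us.
pose t := [seq x - c | x <- s].
have ut : uniq t by rewrite map_inj_uniq // => x y /addIr.
have -> : \sum_(x <- s) expd a c x = \sum_(y <- t) \prod_(i < g) q ^+ `|y i|%N.
  by rewrite big_map; apply: eq_bigr => x _; rewrite -znorm_exp_prod -zdistE.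
(* All coordinates occurring in [t] have absolute value below [N], so [t] lies in a finite cube. A
   coordinate is coded by a sign and an index below [N]; [Negz k] stands for [-(k+1)], so zero has
   only one code. *)
pose N := \max_(y <- t) \max_(i < g) (`|y i|%N).+1.
pose dec (b : bool * 'I_N) : int := if b.1 then Posz b.2 else Negz b.2.
have decN y i : y \in t -> exists b, y i = dec b.
  move=> yt.
  have : (`|y i| < N)%N.
    apply: (leq_trans _ (leq_bigmax_seq _ yt isT)).
    exact: (@leq_bigmax_cond _ xpredT (fun i => (`|y i|%N).+1) i isT).
  case: (y i) => k /= kN; first by exists (true, Ordinal kN).
  by exists (false, Ordinal (ltnW kN)).
pose emb (p : {ffun 'I_g -> bool * 'I_N}) : site g := [ffun i => dec (p i)].
have emb_inj : injective emb.
  move=> p p' /ffunP h; apply/ffunP => i; move: (h i); rewrite !ffunE /dec.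
  by case: (p i) (p' i) => [[] k] [[] l] //= [] /val_inj ->.
have t_emb : {subset t <= [seq emb p | p <- enum {: {ffun 'I_g -> bool * 'I_N}}]}.
  move=> y yt; have [b hb] := choice (fun i => decN y i yt).
  apply/mapP; exists [ffun i => b i]; first by rewrite mem_enum.
  by apply/ffunP => i; rewrite !ffunE.
apply: le_trans (sum_subset_ge0 _ ut _ t_emb) _.
- by move=> y; apply: prodr_ge0 => i _; exact: exprn_ge0.
- by rewrite map_inj_uniq // enum_uniq.
rewrite big_map big_enum /=.
under eq_bigr => p _ do under eq_bigr => i _ do rewrite ffunE.
rewrite -(bigA_distr_bigA (fun (_ : 'I_g) (b : bool * 'I_N) => q ^+ `|dec b|%N)) /=.
rewrite prodr_const card_ord; apply: lerXn2r; rewrite ?nnegrE.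
- by apply: sumr_ge0 => b _; exact: exprn_ge0.
- by rewrite mulr_ge0 // invr_ge0 subr_ge0 ltW.
rewrite -(pair_bigA _ (fun (b : bool) (k : 'I_N) => q ^+ `|dec (b, k)|%N)) /=.
rewrite big_bool /= mulr_natl mulr2n lerD ?geometric_sum_le //.
(* The negative half starts at exponent 1; its extra factor [q] is at most 1. *)
apply: (le_trans _ (geometric_sum_le N q0 q1)); apply: ler_sum => k _.
by rewrite /dec /= exprS ler_piMl ?exprn_ge0 ?(ltW q1).
Qed.

Lemma summ_expd a c : 0 < a -> summ (expd a c).
Proof.
move=> /expd_sum_le [L _ hL]; exists L => s us.
by under eq_bigr do rewrite (ger0_norm (ltW (expd_gt0 _ _ _))); exact: hL.
Qed.

(** By translation invariance of the weight, one finite window [s0], moved to the centre [c], serves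
    every function dominated by a weight around [c]. It bounds the multiplicity of centres and makes
    Parseval uniform in the site. *)
Lemma expd_uniform_tail a B e : 0 < a -> 0 <= B -> 0 < e -> exists2 s0, uniq s0 &
  forall c (h : site g -> R), (forall x, 0 <= h x <= B * expd a c x) ->
  forall s, uniq s -> \sum_(x <- s) h x <= \sum_(y <- s0) h (c + y) + e.
Proof.
move=> a0 B0 e0.
have sB : summ (fun x => B * expd a 0 x) by apply: summZ; exact: summ_expd.
have [s0 us0 tl] := summ_tail sB e0; exists s0 => // c h hB s us.
have h0 x : 0 <= h x by case/andP: (hB x).
pose t := [seq c + y | y <- s0].
have ut : uniq t by rewrite map_inj_uniq // => x y /addrI.
rewrite (sum_split_mem h us ut); apply: lerD.
  rewrite -(big_map (fun y => c + y) xpredT h).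
  by apply: sum_subset_ge0; rewrite ?filter_uniq // => x; rewrite mem_filter => /andP[].
pose r := [seq x - c | x <- s & x \notin t].
apply: le_trans (tl r _ _).
- rewrite big_map; apply: ler_sum => x _.
  rewrite ger0_norm ?mulr_ge0 ?(ltW (expd_gt0 _ _ _)) //.
  by case/andP: (hB x) => _; rewrite /expd !zdistE subr0.
- by rewrite map_inj_uniq ?filter_uniq // => x y /addIr.
move=> _ /mapP [x + ->]; rewrite mem_filter => /andP [xt _].
by apply: contra xt => xs; apply/mapP; exists (x - c) => //; rewrite addrC subrK.
Qed.

(** The triangle inequality trades half of the rate for decay between [c] and [m]; the other half
    leaves a weight that is summable over [x]. *)
Lemma expdM_le a c x m : 0 < a ->
  expd a x c * expd a x m <= expd (a / 2) c m * expd (a / 2) c x.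
Proof.
move=> a0; rewrite /expd -!expRD ler_expR.
have := zdist_triangle x m c; rewrite -(ler_int R) rmorphD /=.
rewrite (zdistC x c); have : 0 <= (zdist m x)%:~R :> R by rewrite ler0z znorm_ge0.
set A := (zdist m x)%:~R; set D := (zdist m c)%:~R; set E := (zdist c x)%:~R => A0 tri.
have h1 : 0 <= a * A by rewrite mulr_ge0 // ltW.
have h2 : 0 <= a * (A + E - D) by rewrite mulr_ge0 ?(ltW a0) // subr_ge0.
nra.
Qed.

End Sites.

(** * Inner product and Bessel residuals *)

Section InnerProduct.
Variables (g : nat) (R : realType).
Implicit Types (u v w : site g -> R[i]) (m : site g).

Lemma conjcD (z w : R[i]) : conjc (z + w) = conjc z + conjc w.
Proof. exact: rmorphD. Qed.

Lemma conjcM (z w : R[i]) : conjc (z * w) = conjc z * conjc w.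
Proof. exact: rmorphM. Qed.

Lemma conjcN (z : R[i]) : conjc (- z) = - conjc z.
Proof. exact: rmorphN. Qed.

Lemma innerE u v : inner u v = csum (fun m => u m * conjc (v m)).
Proof. by []. Qed.

Lemma l2P u : l2 u <-> summ (fun m => normc (u m) ^+ 2).
Proof.
split=> [hu|su].
  exists (fine (\esum_(m in [set: site g]) (normc (u m) ^+ 2)%:E)%E) => s us.
  under eq_bigr do rewrite ger0_norm ?sqr_ge0 //.
  rewrite -lee_fin fineK; first by apply: esum_sup_ge us => x; exact: sqr_ge0.
  by rewrite ge0_fin_numE // esum_ge0 // => m _; rewrite lee_fin sqr_ge0.
have := esum_fin (fun m => sqr_ge0 (normc (u m))) su.
by rewrite ge0_fin_numE // esum_ge0 // => m _; rewrite lee_fin sqr_ge0.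
Qed.

Lemma normc_mul_conj_le (z w : R[i]) :
  normc (z * conjc w) <= normc z ^+ 2 + normc w ^+ 2.
Proof.
rewrite Normc.normcM normc_conj.
have := sqr_ge0 (normc z - normc w).
have := mulr_ge0 (normc_ge0 z) (normc_ge0 w); nra.
Qed.

Lemma l2_summc u v : l2 u -> l2 v -> summc (fun m => u m * conjc (v m)).
Proof.
move=> /l2P su /l2P sv; apply: summc_le (summD su sv) => m.
exact: normc_mul_conj_le.
Qed.

Lemma l2D u v : l2 u -> l2 v -> l2 (fun m => u m + v m).
Proof.
move=> /l2P su /l2P sv; apply/l2P.
apply: summ_le (summZ 2 (summD su sv)) => m.
rewrite ger0_norm ?sqr_ge0 // ger0_norm; last first.
  by rewrite mulr_ge0 // addr_ge0 ?sqr_ge0.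
have h := le_normcD (u m) (v m).
have h2 := sqr_ge0 (normc (u m) - normc (v m)).
have h3 := normc_ge0 (u m + v m).
have h4 : normc (u m + v m) ^+ 2 <= (normc (u m) + normc (v m)) ^+ 2.
  by rewrite lerXn2r ?nnegrE ?addr_ge0 ?normc_ge0.
by nra.
Qed.

Lemma l2Z (c : R[i]) u : l2 u -> l2 (fun m => c * u m).
Proof.
move=> /l2P su; apply/l2P; apply: summ_le (summZ (normc c ^+ 2) su) => m.
by rewrite Normc.normcM exprMn.
Qed.

Lemma l2_0 : l2 (fun _ : site g => 0 : R[i]).
Proof.
by apply/l2P; exists 0 => s _; rewrite big1 // => m _; rewrite Normc.normc0 expr0n normr0.
Qed.

Lemma l2_sum (J : Type) (s : seq J) (b : J -> R[i]) (psi : J -> site g -> R[i]) :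
  (forall j, l2 (psi j)) -> l2 (fun m => \sum_(j <- s) b j * psi j m).
Proof.
move=> hpsi; elim: s => [|j s IH].
  by under eq_fun do rewrite big_nil; exact: l2_0.
under eq_fun do rewrite big_cons.
by apply: l2D IH; exact: l2Z.
Qed.

(** A weight is at most 1, hence dominates its own square; this keeps the rate [a]. *)
Lemma decay_sqr_le (a C : R) u c m : 0 < a ->
  (forall y, normc (u y) <= C * expd a c y) -> normc (u m) ^+ 2 <= C ^+ 2 * expd a c m.
Proof.
move=> a0 hu; apply: (@le_trans _ _ ((C * expd a c m) ^+ 2)).
  rewrite lerXn2r ?nnegrE ?normc_ge0 //.
  exact: le_trans (normc_ge0 _) (hu m).
rewrite exprMn ler_wpM2l ?sqr_ge0 // expr2.
by rewrite ler_piMr ?expd_le1 ?(ltW (expd_gt0 _ _ _)).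
Qed.

Lemma l2_decay (a C : R) c u : 0 < a ->
  (forall m, normc (u m) <= C * expd a c m) -> l2 u.
Proof.
move=> a0 hu; apply/l2P; apply: summ_le (summZ (C ^+ 2) (summ_expd c a0)) => m.
rewrite (ger0_norm (sqr_ge0 _)); apply: le_trans (ler_norm _).
exact: decay_sqr_le a0 hu.
Qed.

Lemma innerDl u v w : l2 u -> l2 v -> l2 w ->
  inner (fun m => u m + v m) w = inner u w + inner v w.
Proof.
move=> hu hv hw; rewrite !innerE -csumD; [|exact: l2_summc..].
by congr csum; apply/funext => m; rewrite mulrDl.
Qed.

Lemma innerZl (c : R[i]) u w : l2 u -> l2 w -> inner (fun m => c * u m) w = c * inner u w.
Proof.
move=> hu hw; rewrite !innerE -csumZ; last exact: l2_summc.
by congr csum; apply/funext => m; rewrite mulrA.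
Qed.

Lemma innerC u v : l2 u -> l2 v -> inner v u = conjc (inner u v).
Proof.
move=> hu hv; rewrite !innerE -csum_conj; last exact: l2_summc.
by congr csum; apply/funext => m; rewrite conjcM conjcK mulrC.
Qed.

Lemma innerDr u v w : l2 u -> l2 v -> l2 w ->
  inner w (fun m => u m + v m) = inner w u + inner w v.
Proof.
move=> hu hv hw; rewrite innerC //; last exact: l2D.
by rewrite innerDl // conjcD -!innerC.
Qed.

Lemma innerZr (c : R[i]) u w : l2 u -> l2 w ->
  inner w (fun m => c * u m) = conjc c * inner w u.
Proof.
move=> hu hw; rewrite innerC //; last exact: l2Z.
by rewrite innerZl // conjcM -innerC.
Qed.

Lemma inner_suml (J : Type) (s : seq J) (b : J -> R[i]) (psi : J -> site g -> R[i]) w :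
  (forall j, l2 (psi j)) -> l2 w ->
  inner (fun m => \sum_(j <- s) b j * psi j m) w = \sum_(j <- s) b j * inner (psi j) w.
Proof.
move=> hpsi hw; elim: s => [|j s IH].
  under eq_fun do rewrite big_nil.
  by rewrite big_nil -[fun _ => 0](_ : (fun m => 0 * (fun _ => 0) m) = _);
    [rewrite innerZl ?mul0r //; exact: l2_0 | apply/funext => m; rewrite mul0r].
under eq_fun do rewrite big_cons.
by rewrite big_cons innerDl ?IH ?innerZl //; [exact: l2Z | exact: l2_sum].
Qed.

Definition delta m : site g -> R[i] := fun n => if n == m then 1 else 0.

Lemma l2_delta m : l2 (delta m).
Proof.
apply/l2P; exists 1 => s us.
have [ms|ms] := boolP (m \in s).
  rewrite (bigD1_seq m) //= big1 ?addr0.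
    by rewrite /delta eqxx Normc.normc1 expr1n normr1.
  by move=> i /negPf im; rewrite /delta im Normc.normc0 expr0n normr0.
rewrite big_seq big1 // => i si; rewrite /delta.
by case: eqP => [im|_]; [rewrite -im si in ms | rewrite Normc.normc0 expr0n normr0].
Qed.

Lemma inner_deltar u m : inner u (delta m) = u m.
Proof.
rewrite innerE -(csum_delta m u); congr csum; apply/funext => n; rewrite /delta.
by case: ifP => _; rewrite ?conjc1 ?mulr1 ?conjc0 ?mulr0.
Qed.

Lemma inner_deltal u m : l2 u -> inner (delta m) u = conjc (u m).
Proof. by move=> hu; rewrite innerC ?inner_deltar //; exact: l2_delta. Qed.

Lemma inner_self_cvg u : l2 u ->
  \sum_(m <- s) normc (u m) ^+ 2 @[s --> @above (site g)] --> complex.Re (inner u u).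
Proof.
move=> hu; have [+ _] := csum_ccvg (l2_summc hu hu).
rewrite (_ : (fun _ => _) = fun s => \sum_(m <- s) normc (u m) ^+ 2) //.
by apply/funext => s; rewrite Re_sum; apply: eq_bigr => m _; rewrite mulr_conjc.
Qed.

Lemma le_inner_self u s : l2 u -> uniq s ->
  \sum_(m <- s) normc (u m) ^+ 2 <= complex.Re (inner u u).
Proof.
move=> hu us; have c := inner_self_cvg hu.
rewrite -(cvg_lim _ c) //; apply: limr_ge; first by apply/cvg_ex; eexists; exact: c.
apply: (filterS _ (above_uniq s)) => t [ut st].
by apply: sum_subset_ge0 us ut st => m; exact: sqr_ge0.
Qed.

Lemma inner_self_ge0 u : l2 u -> 0 <= complex.Re (inner u u).
Proof. by move=> hu; have := @le_inner_self u [::] hu isT; rewrite big_nil. Qed.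

Lemma inner_self_eq0 u : l2 u -> inner u u = 0 -> u = fun _ => 0.
Proof.
move=> hu u0; apply/funext => m; apply: Normc.eq0_normc.
have := @le_inner_self u [:: m] hu isT; rewrite big_seq1 u0 /=.
by rewrite le_eqVlt ltNge sqr_ge0 orbF sqrf_eq0 => /eqP.
Qed.

(** For an orthogonal family of unit or zero vectors, this is [delta m] minus its projection onto
    the span of the [psi j], [j] in [s]; the coefficient [conjc (psi j m)] is the inner product of
    [delta m] with [psi j]. *)
Definition residual (J : Type) (psi : J -> site g -> R[i]) (s : seq J) m : site g -> R[i] :=
  fun n => delta m n + \sum_(j <- s) - conjc (psi j m) * psi j n.

Section Residual.
Variables (J : eqType) (psi : J -> site g -> R[i]).
Hypothesis psi_l2 : forall j, l2 (psi j).
Hypothesis psi_orth : forall j k, j <> k -> inner (psi j) (psi k) = 0.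
Hypothesis psi_idem : forall j, inner (psi j) (psi j) * inner (psi j) (psi j) = inner (psi j) (psi j).

Lemma psi_unit_or_zero j : inner (psi j) (psi j) = 1 \/ psi j = fun _ => 0.
Proof.
have /eqP := psi_idem j; rewrite -subr_eq0 -{3}[inner _ _]mulr1 -mulrBr mulf_eq0 subr_eq0.
by case/orP => /eqP; [right; exact: inner_self_eq0 | left].
Qed.

Lemma residual_l2 s m : l2 (residual psi s m).
Proof. by apply: l2D; [exact: l2_delta | exact: l2_sum]. Qed.

Lemma residual_orth s m k : uniq s -> k \in s -> inner (residual psi s m) (psi k) = 0.
Proof.
move=> us ks; rewrite innerDl ?inner_suml ?inner_deltal //;
  [|exact: l2_delta|exact: l2_sum].
rewrite (bigD1_seq k) //= big1 ?addr0; last first.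
  by move=> j /eqP jk; rewrite psi_orth ?mulr0.
by case: (psi_unit_or_zero k) => ->; [rewrite mulr1 subrr | rewrite conjc0 oppr0 mul0r addr0].
Qed.

Lemma residual_at s m :
  residual psi s m m = ((1 - \sum_(j <- s) normc (psi j m) ^+ 2)%:C)%C.
Proof.
rewrite /residual /delta eqxx rmorphB rmorph1 rmorph_sum /= -sumrN; congr (_ + _).
by apply: eq_bigr => j _; rewrite mulNr mulrC mulr_conjc.
Qed.

(** The residual is orthogonal to what was subtracted from [delta m], so its squared norm is its
    inner product with [delta m], that is, its value at [m]. *)
Lemma residual_norm s m : uniq s ->
  inner (residual psi s m) (residual psi s m)
    = ((1 - \sum_(j <- s) normc (psi j m) ^+ 2)%:C)%C.
Proof.
move=> us; have rl2 := residual_l2 s m.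
rewrite {2}/residual innerDr //; [|exact: l2_delta|exact: l2_sum].
rewrite inner_deltar residual_at [X in _ + X](_ : _ = 0) ?addr0 //.
rewrite innerC ?inner_suml //; last exact: l2_sum.
rewrite big_seq big1 ?conjc0 // => j js.
by rewrite innerC // residual_orth // conjc0 mulr0.
Qed.

Lemma bessel s m : uniq s -> \sum_(j <- s) normc (psi j m) ^+ 2 <= 1.
Proof.
move=> us; have := inner_self_ge0 (residual_l2 s m).
by rewrite residual_norm //= subr_ge0.
Qed.

(* [0 <= ||u - t u(m) r||^2] for the residual [r] of [delta m], which satisfies
   [<u, r> = u(m)] and whose norm is arbitrarily small. *)
Lemma parseval_complete u :
  (forall m e, 0 < e -> exists2 s, uniq s & 1 - e <= \sum_(j <- s) normc (psi j m) ^+ 2) ->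
  l2 u -> (forall j, inner u (psi j) = 0) -> u = fun _ => 0.
Proof.
move=> pars hu uorth; apply/funext => m; apply: contrapT => um0.
pose A := normc (u m) ^+ 2; pose N := complex.Re (inner u u).
have A0 : 0 < A.
  rewrite exprn_gt0 // lt_neqAle normc_ge0 andbT eq_sym; apply/eqP.
  by move=> /Normc.eq0_normc.
have N0 : 0 <= N by exact: inner_self_ge0.
(* This gives [t * A = N + 1 + A]. With [1 - S <= t ^- 2], the squared norm
   [N - 2 t A + t^2 (1 - S) A] is at most [N - 2 t A + A = - N - 2 - A < 0]. *)
pose t := (N + 1) / A + 1.
have t1 : 1 <= t by rewrite lerDr divr_ge0 ?(ltW A0) //; lra.
have e0 : 0 < t ^- 2 by rewrite invr_gt0 exprn_gt0 //; lra.
have [s us hs] := pars m _ e0.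
have rl2 := residual_l2 s m.
pose r := residual psi s m.
have ur : inner u r = u m.
  rewrite /r /residual innerDr //; [|exact: l2_delta|exact: l2_sum].
  rewrite inner_deltar innerC //; last exact: l2_sum.
  rewrite inner_suml // big1 ?conjc0 ?addr0 // => j _.
  by rewrite innerC // uorth conjc0 mulr0.
pose la : R[i] := - ((t%:C)%C * u m).
have vl2 : l2 (fun n => u n + la * r n) by apply: l2D => //; exact: l2Z.
have := inner_self_ge0 vl2.
have lr : l2 (fun n => la * r n) by exact: l2Z.
rewrite innerDl // !innerDr // !innerZl // !innerZr //.
rewrite (innerC hu rl2) -/r ur residual_norm //.
set S := \sum_(j <- s) _ in hs *.
have -> : conjc la = - ((t%:C)%C * conjc (u m)) by rewrite /la conjcN conjcM conjc_real.
have -> : inner u u + - ((t%:C)%C * conjc (u m)) * u m +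
    (la * conjc (u m) + la * (- ((t%:C)%C * conjc (u m)) * ((1 - S)%:C)%C)) =
    inner u u + (- (2 * t) + t ^+ 2 * (1 - S))%:C%C * (u m * conjc (u m)).
  have -> : ((- (2 * t) + t ^+ 2 * (1 - S))%:C)%C
      = - (2 * (t%:C)%C) + (t%:C)%C ^+ 2 * ((1 - S)%:C)%C :> R[i].
    by rewrite !expr2 (rmorphD _ (- (2 * t))) rmorphN !rmorphM rmorph_nat.
  by rewrite /la; ring.
rewrite mulr_conjc -rmorphM ReD -/N [complex.Re _]/= -/A => h.
have tA : t * A = N + 1 + A by rewrite /t mulrDl mul1r divfK // gt_eqF.
have tS : t ^+ 2 * (1 - S) <= 1.
  have : 1 - S <= t ^- 2 by lra.
  by rewrite -(ler_pM2l (_ : 0 < t ^+ 2)) ?exprn_gt0 ?divff ?gt_eqF ?exprn_gt0 //; lra.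
have : (t ^+ 2 * (1 - S)) * A <= 1 * A by rewrite ler_wpM2r // ltW.
clearbody t A N S; nra.
Qed.

End Residual.

End InnerProduct.

(** * Localized frames and their limits *)

(** If no list exhausted [P], every list in [P] could be extended, and one of length [K.+1] would
    exist. *)
Lemma bounded_pred_enum (J : eqType) (P : J -> Prop) (K : nat) :
  (forall t : seq J, uniq t -> (forall k, k \in t -> P k) -> (size t <= K)%N) ->
  exists t : seq J, [/\ uniq t, (forall k, k \in t <-> P k) & (size t <= K)%N].
Proof.
move=> bd; apply: contrapT => hN.
have big n : exists t : seq J, [/\ uniq t, (forall k, k \in t -> P k) & size t = n].
  elim: n => [|n [t [ut tP st]]]; first by exists [::].
  have [k [Pk kt]] : exists k, P k /\ k \notin t.
    apply: contrapT => hk; apply: hN; exists t; split=> //; last exact: bd.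
    move=> k; split; first exact: tP.
    by move=> Pk; apply/negPn/negP => kt; apply: hk; exists k.
  exists (k :: t); split; rewrite /= ?kt ?st //.
  by move=> l; rewrite inE => /orP [/eqP -> //|]; exact: tP.
have [t [ut tP st]] := big K.+1.
by have := bd t ut tP; rewrite st ltnn.
Qed.

(** Replaces an arbitrary index type by centre and label, the index set on which translates can be
    compared. The map is partial because a fibre may have fewer than [K] elements. *)
Lemma fiber_labelling (J : eqType) (S : Type) (c : J -> S) (K : nat) :
  (forall x (t : seq J), uniq t -> (forall k, k \in t -> c k = x) -> (size t <= K)%N) ->
  exists lab : S * 'I_K -> option J,
    [/\ forall j k, lab j = Some k -> c k = j.1,
        forall j j' k, lab j = Some k -> lab j' = Some k -> j = j'
      & forall k, exists j, lab j = Some k].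
Proof.
move=> bd.
have [e he] := choice (fun x => bounded_pred_enum (bd x)).
(* The label is the position in the list of the fibre; [onth] returns [None] past its end. *)
pose lab (j : S * 'I_K) := onth (e j.1) j.2.
have labP j k : lab j = Some k -> k \in e j.1 /\ j.2 = index k (e j.1) :> nat.
  move=> h; split; first by apply/onthP; exists j.2.
  have hs : (j.2 < size (e j.1))%N by rewrite -onthTE; move: h; rewrite /lab => ->.
  have hk : nth k (e j.1) j.2 = k by exact: onth_nth.
  by rewrite -[in RHS]hk index_uniq //; case: (he j.1).
have lab1 j k : lab j = Some k -> c k = j.1.
  by move=> /labP [h _]; case: (he j.1) => _ /(_ k) [H _] _; exact: H.
exists lab; split=> //.
  move=> [x i] [x' i'] k h h'.
  have xx : x = x' by rewrite -[x](lab1 _ _ h) -[x'](lab1 _ _ h').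
  rewrite -xx in h' *; congr pair; apply/val_inj.
  by case: (labP _ _ h) (labP _ _ h') => _ /= -> [_ ->].
move=> k; case: (he (c k)) => ut /(_ k) [_ /(_ erefl) kt] st.
have ik : (index k (e (c k)) < K)%N by rewrite (leq_trans _ st) // index_mem.
exists (c k, Ordinal ik); by rewrite /lab /= onthE (nth_map k) ?nth_index ?index_mem.
Qed.

Section Frames.
Variables (g : nat) (R : realType).
Implicit Types (V : site g -> R) (u : site g -> R[i]) (m x y : site g).

(** [Hop] at [w] is convertible to this operator with the potential sampled along the orbit of [w],
    so only potentials have to be translated and passed to the limit. *)
Definition schrodinger V u : site g -> R[i] :=
  fun n => \sum_(i < g) (u (Defs.shift n i 1) + u (Defs.shift n i (-1))) + ((V n)%:C)%C * u n.

(* The proportionality [H psi y * psi m = psi y * H psi m] expresses that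
   [psi] is an eigenfunction or zero without naming the eigenvalue, so that it
   passes to pointwise limits. *)
Record localized_frame V (K : nat) (a C : R) (S : R -> seq (site g))
    (psi : site g * 'I_K -> site g -> R[i]) : Prop := LocalizedFrame {
  frame_decay : forall j m, normc (psi j m) <= C * expd a j.1 m;
  frame_eigen : forall j y m,
    schrodinger V (psi j) y * psi j m = psi j y * schrodinger V (psi j) m;
  frame_orth : forall j k, j <> k -> inner (psi j) (psi k) = 0;
  frame_idem : forall j,
    inner (psi j) (psi j) * inner (psi j) (psi j) = inner (psi j) (psi j);
  frame_parseval : forall e, 0 < e -> uniq (S e) /\
    forall m, 1 - e <= \sum_(x <- S e) \sum_(i < K) normc (psi (m + x, i) m) ^+ 2 }.

Lemma shiftD m (n : site g) (i : 'I_g) s : Defs.shift m i s + n = Defs.shift (m + n) i s.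
Proof. by apply/ffunP => j; rewrite !ffunE; case: ifP => // _; rewrite addrAC. Qed.

Lemma rsum_translate (h : site g -> R) (n : site g) : rsum (fun m => h (m + n)) = rsum h.
Proof.
have b : set_bij [set: site g] [set: site g] (fun m => m + n).
  split=> //; first by move=> x y _ _ /addIr.
  by move=> y _; exists (y - n) => //; rewrite subrK.
rewrite /rsum; congr (fine _ - fine _).
- by rewrite (reindex_esum _ _ _ (fun m => (Num.max (h m) 0)%:E) b).
- by rewrite (reindex_esum _ _ _ (fun m => (Num.max (- h m) 0)%:E) b).
Qed.

Lemma inner_translate u v (n : site g) :
  inner (fun m => u (m + n)) (fun m => v (m + n)) = inner u v.
Proof.
by rewrite /inner (rsum_translate (fun m => complex.Re (u m * conjc (v m))))
  (rsum_translate (fun m => complex.Im (u m * conjc (v m)))).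
Qed.

(** The centre is translated together with the argument, so the function labelled [(x, i)] is again
    centred at [x]. The data [K], [a], [C], [S] do not change, which makes the bounds uniform over
    the orbit. *)
Lemma frame_translate V K a C S psi (n : site g) : @localized_frame V K a C S psi ->
  localized_frame (fun m => V (m + n)) a C S (fun j m => psi (j.1 + n, j.2) (m + n)).
Proof.
move=> [dec eig orth idem pars]; split.
- by move=> j m; have := dec (j.1 + n, j.2) (m + n); rewrite /expd /= zdistD2r.
- move=> j y m; have := eig (j.1 + n, j.2) (y + n) (m + n).
  rewrite /schrodinger; set p := psi _ => h.
  have E z : \sum_(i < g) (p (Defs.shift z i 1 + n) + p (Defs.shift z i (-1) + n)) =
     \sum_(i < g) (p (Defs.shift (z + n) i 1) + p (Defs.shift (z + n) i (-1))).
    by apply: eq_bigr => i _; rewrite !shiftD.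
  by rewrite !E.
- move=> [x i] [x' i'] jk; rewrite inner_translate orth //= => -[] /addIr xx ii.
  by apply: jk; rewrite xx ii.
- by move=> j; rewrite inner_translate.
- move=> e e0; have [us h] := pars e e0; split=> // m; have := h (m + n).
  by under eq_bigr => x _ do under eq_bigr => i _ do rewrite addrAC.
Qed.

(** Decay of one factor around a centre [x] independent of [n], with boundedness of the other, gives
    a summable majorant. *)
Lemma inner_dominated (N : Type) (F : set_system N) (FF : ProperFilter F)
    (u v : N -> site g -> R[i]) (u0 v0 : site g -> R[i]) (a C D : R) x :
  0 < a -> 0 <= C ->
  (forall n m, normc (u n m) <= C * expd a x m) -> (forall n m, normc (v n m) <= D) ->
  (forall m, ccvg F (fun n => u n m) (u0 m)) -> (forall m, ccvg F (fun n => v n m) (v0 m)) ->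
  ccvg F (fun n => inner (u n) (v n)) (inner u0 v0).
Proof.
move=> a0 C0 hu hv cu cv.
apply: (@csum_dominated R _ _ F _ _ _ (fun m => (D * C) * expd a x m)).
- by apply: summZ; exact: summ_expd.
- move=> n m; rewrite Normc.normcM normc_conj mulrC -mulrA.
  by apply: ler_pM => //; exact: normc_ge0.
- by move=> m; apply: ccvgM => //; exact: ccvg_conj.
Qed.

(** Bounded values have limits along [U], and every field is a closed condition on them: inner
    products converge by domination, and the operator involves finitely many sites. In the Parseval
    field the window [S e] is common to all [n], so no mass escapes to infinity. *)
Lemma frame_ultralimit (N : Type) (U : set_system N) (UU : UltraFilter U)
    (Vn : N -> site g -> R) V K a C S psin :
  0 < a -> 0 <= C ->
  (forall n, @localized_frame (Vn n) K a C S (psin n)) ->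
  (forall m, Vn n m @[n --> U] --> V m) ->
  exists psi, @localized_frame V K a C S psi.
Proof.
move=> a0 C0 fr VnV.
have [psi cpsi] : {psi & forall p : (site g * 'I_K) * site g,
    ccvg U (fun n => psin n p.1 p.2) (psi p)}.
  apply: (@choice _ _ (fun p => ccvg U (fun n => psin n p.1 p.2))) => -[j m] /=.
  apply: ultra_bounded_ccvg => n.
  exact: (frame_decay (fr n) j m).
have cp j m : ccvg U (fun n => psin n j m) (psi (j, m)) by exact: (cpsi (j, m)).
have cinner j k : ccvg U (fun n => inner (psin n j) (psin n k))
    (inner (fun m => psi (j, m)) (fun m => psi (k, m))).
  apply: (@inner_dominated _ _ _ _ _ _ _ a C C j.1) => // n m.
    exact: (frame_decay (fr n)).
  apply: le_trans (frame_decay (fr n) k m) _.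
  by rewrite ler_piMr ?expd_le1.
have cH j y : ccvg U (fun n => schrodinger (Vn n) (psin n j) y)
    (schrodinger V (fun m => psi (j, m)) y).
  apply: ccvgD; first by apply: ccvg_sum => i; exact: ccvgD.
  by apply: ccvgM => //; exact: ccvg_real.
exists (fun j m => psi (j, m)); split.
- by move=> j m; apply: (ccvg_normc_le (cp j m)) => n; exact: (frame_decay (fr n)).
- move=> j y m.
  have c : ccvg U (fun n => psin n j y * schrodinger (Vn n) (psin n j) m)
      (psi (j, y) * schrodinger V (fun m => psi (j, m)) m) by apply: ccvgM.
  apply: ccvg_unique c.
  rewrite (_ : (fun _ => _) = fun n => schrodinger (Vn n) (psin n j) y * psin n j m).
    by apply: ccvgM (cH j y) (cp j m).
  by apply/funext => n; rewrite (frame_eigen (fr n)).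
- move=> j k jk; apply: (ccvg_near_cst (cinner j k)).
  by apply: filterE => n; exact: (frame_orth (fr n)).
- move=> j; apply: ccvg_unique (cinner j j).
  rewrite (_ : (fun _ => _) =
      fun n => inner (psin n j) (psin n j) * inner (psin n j) (psin n j)).
    by apply: ccvgM.
  by apply/funext => n; rewrite (frame_idem (fr n)).
- move=> e e0; split.
    by have [n _] := filter_ex (@filterT _ U _); case: (frame_parseval (fr n) e0).
  move=> m.
  have c : \sum_(x <- S e) \sum_(i < K) normc (psin n (m + x, i) m) ^+ 2 @[n --> U] -->
      \sum_(x <- S e) \sum_(i < K) normc (psi ((m + x, i), m)) ^+ 2.
    apply: cvg_big => [|x _]; first exact: add_continuous.
    apply: cvg_big => [|i _]; first exact: add_continuous.
    exact: ccvg_normc2.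
  rewrite -(cvg_lim _ c) //; apply: limr_ge; first by apply/cvg_ex; eexists; exact: c.
  by apply: filterE => n; case: (frame_parseval (fr n) e0).
Qed.

Lemma frame_l2 V K a C S psi j : 0 < a -> @localized_frame V K a C S psi -> l2 (psi j).
Proof. by move=> a0 fr; apply: (l2_decay a0) (frame_decay fr j). Qed.

Lemma inner0r u : l2 u -> inner u (fun _ => 0) = 0.
Proof.
move=> hu; rewrite -[fun _ => 0](_ : (fun m : site g => 0 * (fun _ => 0 : R[i]) m) = _).
  by rewrite innerZr ?conjc0 ?mul0r //; exact: l2_0.
by apply/funext => m; rewrite mul0r.
Qed.

Lemma frame_ULE V K a C S psi : 0 < a -> @localized_frame V K a C S psi ->
  ULE_with (schrodinger V) a C.
Proof.
move=> a0 fr.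
have pl2 j : l2 (psi j) by exact: frame_l2 fr.
(* The zero members of the frame are discarded. *)
pose I := {j : site g * 'I_K | `[< inner (psi j) (psi j) = 1 >]}.
exists I, (fun k => psi (val k)), (fun k => (val k).1); split; [|split; [|split; [|split; [|split]]]].
- by move=> k; exact: pl2.
- move=> [j /= /asboolP j1].
  have [m pm] : exists m, psi j m != 0.
    apply: contrapT => hN; have p0 : psi j = fun _ => 0.
      by apply/funext => m; apply/eqP/negPn/negP => h; apply: hN; exists m.
    by move: j1; rewrite {2}p0 inner0r // => /esym/eqP; rewrite oner_eq0.
  (* The eigenvalue is read off at a site where [psi j] does not vanish. *)
  exists (schrodinger V (psi j) m / psi j m) => y.
  apply: (mulIf pm); rewrite (frame_eigen fr) mulrAC divfK //; exact: mulrC.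
- by move=> [j /= /asboolP].
- by move=> k l kl; apply: (frame_orth fr) => /val_inj.
- move=> u hu uorth.
  apply: (parseval_complete pl2 (frame_orth fr) (frame_idem fr)) => //.
    move=> m e e0; have [us h] := frame_parseval fr e0.
    (* All labels with centres in the window moved to [m]. *)
    exists [seq (m + x, i) | x <- S e, i <- enum 'I_K].
      by apply: allpairs_uniq; rewrite ?enum_uniq // => -[x i] [y j] _ _ /= [] /addrI -> ->.
    rewrite big_allpairs_dep; apply: le_trans (h m) _.
    by apply: ler_sum => x _; rewrite big_enum.
  move=> j; have [j1|->] := psi_unit_or_zero pl2 (frame_idem fr) j; last exact: inner0r.
  by apply: (uorth (exist _ j _)); apply/asboolP.
- by move=> k m; exact: (frame_decay fr).
Qed.

End Frames.

(** * From ULE to a localized frame *)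

Lemma sumr_const_seq (V : nmodType) (J : Type) (t : seq J) (v : V) :
  \sum_(k <- t) v = v *+ size t.
Proof. by rewrite big_const_seq count_predT iter_addr_0. Qed.

Section FrameOfULE.
Variables (g : nat) (R : realType).
Implicit Types (V : site g -> R) (u : site g -> R[i]) (m x y : site g).

(* A normalised function centred at [x] has at least half of its mass in a
   fixed finite neighbourhood of [x], where by Bessel the total mass of an
   orthonormal family is bounded. *)
Lemma center_multiplicity (J : choiceType) (phi : J -> site g -> R[i])
    (c : J -> site g) (a C : R) : 0 < a ->
  (forall k m, normc (phi k m) <= C * expd a (c k) m) ->
  (forall k, inner (phi k) (phi k) = 1) ->
  (forall k l, k <> l -> inner (phi k) (phi l) = 0) ->
  exists K, forall x (t : seq J),
    uniq t -> (forall k, k \in t -> c k = x) -> (size t <= K)%N.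
Proof.
move=> a0 dec nrm orth.
have pl2 k : l2 (phi k) by exact: l2_decay a0 (dec k).
have half : 0 < 1 / 2 :> R by lra.
have [s0 us0 tail] := @expd_uniform_tail g R a (C ^+ 2) (1 / 2) a0 (sqr_ge0 _) half.
(* Each function has mass at least 1/2 on the window at [x], and Bessel allows total mass 1 at each
   of its [size s0] sites. *)
exists (2 * size s0)%N => x t ut tx.
have mass k : 1 / 2 <= \sum_(y <- s0) normc (phi k (c k + y)) ^+ 2.
  have cv := inner_self_cvg (pl2 k); rewrite nrm /= in cv.
  suff : 1 <= \sum_(y <- s0) normc (phi k (c k + y)) ^+ 2 + 1 / 2 by lra.
  rewrite -[leLHS](cvg_lim _ cv) //; apply: limr_le.
    by apply/cvg_ex; eexists; exact: cv.
  apply: (filterS _ (above_uniq [::])) => s [us _].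
  apply: (tail (c k) (fun y => normc (phi k y) ^+ 2)) => // y.
  by rewrite sqr_ge0 (decay_sqr_le _ a0 (dec k)).
have lower : (1 / 2) * (size t)%:R <= \sum_(k <- t) \sum_(y <- s0) normc (phi k (x + y)) ^+ 2.
  rewrite mulr_natr -sumr_const_seq [leRHS]big_seq big_seq.
  by apply: ler_sum => k /tx <-.
have upper : \sum_(k <- t) \sum_(y <- s0) normc (phi k (x + y)) ^+ 2 <= (size s0)%:R.
  rewrite exchange_big /= -[leRHS]mulr1 mulr_natl -sumr_const_seq.
  apply: ler_sum => y _; apply: bessel => // k; by rewrite nrm mul1r.
by rewrite -(ler_nat R) natrM; lra.
Qed.

Definition labelled (J : Type) (phi : J -> site g -> R[i]) K
    (lab : site g * 'I_K -> option J) (j : site g * 'I_K) : site g -> R[i] :=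
  if lab j is Some k then phi k else fun=> 0.

Lemma delta_le_expd (b : R) m y : normc (delta R m y) <= expd b m y.
Proof.
rewrite /delta; case: eqP => [->|_]; last by rewrite Normc.normc0 ltW ?expd_gt0.
rewrite Normc.normc1 /expd (_ : zdist m m = 0) ?mulr0 ?expR0 //.
by rewrite zdistE subrr /znorm big1 // => i _; rewrite ffunE normr0.
Qed.

(** [expdM_le] splits each subtracted term into decay at rate [a / 2] from [m] to [y] and a weight
    summable over the centres. In the constant, 1 accounts for [delta m] and the factor [K] for the
    labels; [D] depends neither on [m] nor on [s]. *)
Lemma residual_decay (a C : R) (K : nat) (psi : site g * 'I_K -> site g -> R[i]) :
  0 < a -> 0 <= C -> (forall j m, normc (psi j m) <= C * expd a j.1 m) ->
  exists2 D, 0 <= D & forall m (s : seq (site g)), uniq s -> forall y,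
    normc (residual psi [seq (x, i) | x <- s, i <- enum 'I_K] m y)
      <= D * expd (a / 2) m y.
Proof.
move=> a0 C0 dec.
have a20 : 0 < a / 2 by lra.
have [L L0 hL] := @expd_sum_le g R _ a20.
exists (1 + C ^+ 2 * L *+ K); first by rewrite addr_ge0 ?mulrn_wge0 ?mulr_ge0 ?sqr_ge0.
move=> m s us y; apply: le_trans (le_normcD _ _) _.
rewrite mulrDl mul1r lerD ?delta_le_expd //.
apply: le_trans (normc_sum _ _) _; rewrite big_allpairs_dep.
apply: (@le_trans _ _ (\sum_(x <- s)
    (C ^+ 2 * expd (a / 2) m y *+ K) * expd (a / 2) m x)).
  apply: ler_sum => x _; rewrite big_enum /=.
  rewrite mulrnAl -[in leRHS](card_ord K) -sumr_const; apply: ler_sum => i _.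
  rewrite mulNr normcN Normc.normcM normc_conj.
  apply: le_trans (ler_pM (normc_ge0 _) (normc_ge0 _) (dec _ _) (dec _ _)) _.
  rewrite mulrACA -expr2 -mulrA ler_wpM2l ?sqr_ge0 //.
  exact: expdM_le.
rewrite -mulr_sumr.
apply: le_trans (ler_wpM2l _ (hL m s us)) _; last by rewrite !mulrnAl mulrAC.
by rewrite mulrn_wge0 // mulr_ge0 ?sqr_ge0 ?(ltW (expd_gt0 _ _ _)).
Qed.

(** If the Parseval sums at [m] stayed below [1 - e], the residuals of [delta m] would have values
    above [e] at [m]. Their limit along an ultrafilter of growing finite sets decays, is orthogonal
    to every [phi k], and so vanishes by completeness, a contradiction. *)
Lemma labelled_parseval_at (J : choiceType) (phi : J -> site g -> R[i])
    (K : nat) (lab : site g * 'I_K -> option J) (a C : R) :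
  0 < a -> 0 <= C ->
  (forall j m, normc (labelled phi lab j m) <= C * expd a j.1 m) ->
  (forall j k, j <> k -> inner (labelled phi lab j) (labelled phi lab k) = 0) ->
  (forall j, inner (labelled phi lab j) (labelled phi lab j)
     * inner (labelled phi lab j) (labelled phi lab j)
     = inner (labelled phi lab j) (labelled phi lab j)) ->
  (forall k, exists j, lab j = Some k) ->
  (forall u, l2 u -> (forall k, inner u (phi k) = 0) -> u = fun=> 0) ->
  forall m e, 0 < e -> exists2 s, uniq s &
    1 - e <= \sum_(x <- s) \sum_(i < K) normc (labelled phi lab (x, i) m) ^+ 2.
Proof.
set psi := labelled phi lab => a0 C0 dec orth idem surj compl m e e0.
apply: contrapT => hN.
have pl2 j : l2 (psi j) by exact: l2_decay a0 (dec j).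
have a20 : 0 < a / 2 by lra.
(* [undup] makes the residual bound hold for every list, as convergence along the ultrafilter is
   applied to functions on all lists. *)
pose prs (s : seq (site g)) := [seq (x, i) | x <- undup s, i <- enum 'I_K].
have uprs s : uniq (prs s).
  by apply: allpairs_uniq; rewrite ?undup_uniq ?enum_uniq // => -[x i] [y j] _ _ /= [-> ->].
pose r s := residual psi (prs s) m.
have [D D0 rD] := residual_decay a0 C0 dec.
have rb s y : normc (r s y) <= D * expd (a / 2) m y by exact: rD (undup_uniq s) y.
have [U [UU aU]] := @ultraFilterLemma _ (@above (site g)) _.
have [w cw] : {w & forall y, ccvg U (fun s => r s y) (w y)}.
  apply: (@choice _ _ (fun y => ccvg U (fun s => r s y))) => y.
  exact: ultra_bounded_ccvg (fun s => rb s y).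
have wb y : normc (w y) <= D * expd (a / 2) m y.
  by apply: (ccvg_normc_le (cw y)) => s.
have wl2 : l2 w by exact: l2_decay a20 wb.
have w0 : w = fun=> 0.
  apply: compl => // k; have [j hj] := surj k.
  have pj : psi j = phi k by rewrite /psi /labelled hj.
  have ci : ccvg U (fun s => inner (r s) (psi j)) (inner w (psi j)).
    apply: (@inner_dominated _ _ _ _ _ _ _ _ _ (a / 2) D C m) => //.
    - move=> s y; apply: le_trans (dec j y) _.
      by rewrite ler_piMr ?expd_le1.
    - by move=> y; exact: ccvg_cst.
  rewrite -pj; apply: (ccvg_near_cst ci); apply: aU.
  (* Once the list contains the centre of [j], the residual is orthogonal to [psi j]. *)
  apply: (filterS _ (above_uniq [:: j.1])) => s [us /(_ j.1)].
  rewrite inE eqxx => /(_ isT) js; apply: residual_orth => //.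
  by apply/allpairsP; exists j; rewrite mem_undup mem_enum -surjective_pairing.
have [c1 _] := cw m; rewrite w0 /= in c1.
suff : e <= 0 by rewrite leNgt e0.
rewrite -(cvg_lim _ c1) //; apply: limr_ge; first by apply/cvg_ex; eexists; exact: c1.
apply: aU; apply: (filterS _ (above_uniq [::])) => s [us _].
rewrite /r residual_at /= big_allpairs_dep undup_id //.
rewrite leNgt; apply/negP => h; apply: hN; exists s => //.
have E : \sum_(x <- s) \sum_(i <- enum 'I_K) normc (psi (x, i) m) ^+ 2
   = \sum_(x <- s) \sum_(i < K) normc (psi (x, i) m) ^+ 2.
  by apply: eq_bigr => x _; rewrite big_enum.
by move: h; rewrite E; lra.
Qed.

(** The multiplicity bound supplies the labels, and labels left empty carry the zero function.
    Completeness becomes a Parseval bound at each site, which uniform tails turn into windows [S e]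
    valid at all sites. *)
Lemma ULE_frame V (a C : R) : 0 < a -> 0 < C -> ULE_with (schrodinger V) a C ->
  exists K S psi, @localized_frame g R V K a C S psi.
Proof.
move=> a0 C0 [I [phi [c [pl2 [eig [nrm [orth [compl dec]]]]]]]].
pose J : choiceType := {classic I}.
have [K hK] := @center_multiplicity J phi c a C a0 dec nrm orth.
have [lab [lab1 lab_inj surj]] := @fiber_labelling J (site g) c K hK.
pose psi := @labelled J phi K lab.
have zl2 : l2 (fun _ : site g => 0 : R[i]) by exact: l2_0.
have pdec j m : normc (psi j m) <= C * expd a j.1 m.
  rewrite /psi /labelled; case E: (lab j) => [k|]; first by rewrite -(lab1 _ _ E); exact: dec.
  by rewrite Normc.normc0 mulr_ge0 ?ltW ?expd_gt0.
have inner0l u : l2 u -> inner (fun _ => 0) u = 0.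
  by move=> hu; rewrite (innerC hu zl2) inner0r // conjc0.
have porth j k : j <> k -> inner (psi j) (psi k) = 0.
  rewrite /psi /labelled; case Ej: (lab j) => [p|]; case Ek: (lab k) => [q|] jk.
  - by apply: orth => pq; apply: jk; apply: (lab_inj _ _ p) => //; rewrite Ek pq.
  - exact: inner0r.
  - exact: inner0l.
  - exact: inner0r.
have pidem j : inner (psi j) (psi j) * inner (psi j) (psi j) = inner (psi j) (psi j).
  rewrite /psi /labelled; case: (lab j) => [k|]; first by rewrite nrm mulr1.
  by rewrite inner0r ?mulr0.
have pars := @labelled_parseval_at J phi K lab a C a0 (ltW C0) pdec porth pidem surj compl.
have KC0 : 0 <= C ^+ 2 *+ K by rewrite mulrn_wge0 ?sqr_ge0.
have [S hS] : {S : R -> seq (site g) & forall e, 0 < e -> uniq (S e) /\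
    forall m, 1 - e <= \sum_(x <- S e) \sum_(i < K) normc (psi (m + x, i) m) ^+ 2}.
  apply: (@choice _ _ (fun e (S : seq (site g)) => 0 < e -> uniq S /\
    forall m, 1 - e <= \sum_(x <- S) \sum_(i < K) normc (psi (m + x, i) m) ^+ 2)) => e.
  have [e0|e0] := boolP (0 < e); last by exists [::].
  have e2 : 0 < e / 2 by lra.
  (* As a function of the centre, the mass at [m] is dominated by a weight around [m], so centres
     outside [m + s0] contribute at most [e / 2]; the other [e / 2] is lost in Parseval at [m]. *)
  have [s0 us0 tail] := @expd_uniform_tail g R a _ _ a0 KC0 e2.
  exists s0 => _; split=> // m; have [s us hs] := pars m _ e2.
  suff : \sum_(x <- s) \sum_(i < K) normc (psi (x, i) m) ^+ 2 <=
      \sum_(x <- s0) \sum_(i < K) normc (psi (m + x, i) m) ^+ 2 + e / 2.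
    by move: hs; rewrite -/psi; lra.
  apply: (tail m (fun x => \sum_(i < K) normc (psi (x, i) m) ^+ 2)) => // x.
  rewrite sumr_ge0 /=; last by move=> i _; exact: sqr_ge0.
  rewrite mulrnAl -[leRHS](_ : \sum_(i < K) C ^+ 2 * expd a m x = _);
    last by rewrite sumr_const card_ord.
  apply: ler_sum => i _.
  by have := decay_sqr_le m a0 (pdec (x, i)); rewrite /expd zdistC.
exists K, S, psi; split=> // j y m.
rewrite /psi /labelled; case: (lab j) => [k|]; last by rewrite mulr0 mul0r.
by have [E hE] := eig k; rewrite !hE mulrAC mulrC.
Qed.

End FrameOfULE.

(** * The action *)

Section Dynamics.
Variables (g : nat) (X : topologicalType) (T Tinv : 'I_g -> X -> X).
Hypotheses (hK1 : forall i, cancel (T i) (Tinv i)) (hK2 : forall i, cancel (Tinv i) (T i)).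
Hypothesis hcomm : forall i j, T i \o T j = T j \o T i.

Let pw i := powZ (T i) (Tinv i).

Let T_comm i j x : T i (T j x) = T j (T i x).
Proof. exact: (congr1 (fun h => h x) (hcomm i j)). Qed.

Lemma powZ_add1 i k x : pw i (k + 1) x = T i (pw i k x).
Proof.
case: k => [n|[|n]]; rewrite /pw.
- by rewrite addrC.
- by rewrite /= hK2.
- by rewrite (_ : Negz n.+1 + 1 = Negz n) /= ?hK2 // !NegzE -[n.+2]addn1 PoszD opprD subrK.
Qed.

Lemma powZ_sub1 i k x : pw i (k - 1) x = Tinv i (pw i k x).
Proof. by rewrite -[k in RHS](subrK 1) powZ_add1 hK1. Qed.

Lemma powZD i k l x : pw i (k + l) x = pw i k (pw i l x).
Proof.
elim/int_rect: k => [|n IH|n IH]; first by rewrite add0r.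
- by rewrite -addn1 PoszD addrAC !powZ_add1 IH.
- by rewrite -addn1 PoszD opprD addrAC !powZ_sub1 IH.
Qed.

Lemma powZ_commute i (h : X -> X) : (forall x, T i (h x) = h (T i x)) ->
  forall k x, pw i k (h x) = h (pw i k x).
Proof.
move=> hT; have hTinv x : Tinv i (h x) = h (Tinv i x).
  by apply: (can_inj (hK1 i)); rewrite hK2 hT hK2.
elim/int_rect => [//|n IH|n IH] x.
- by rewrite -addn1 PoszD !powZ_add1 IH hT.
- by rewrite -addn1 PoszD opprD !powZ_sub1 IH hTinv.
Qed.

(** [Tpow] with an arbitrary list of directions in place of [enum 'I_g], for induction on the
    list. *)
Let pwl (l : seq 'I_g) (n : site g) : X -> X := foldr (fun i h => pw i (n i) \o h) id l.

Let pwl_commute l n i x : T i (pwl l n x) = pwl l n (T i x).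
Proof.
elim: l => //= j l IH; rewrite -(@powZ_commute j (T i)) ?IH // => y; exact: T_comm.
Qed.

(** Commutativity moves the [n i]-th power of [T i] past the remaining factors of the [m]-th one. *)
Lemma TpowD (m n : site g) x : Tpow T Tinv (m + n) x = Tpow T Tinv m (Tpow T Tinv n x).
Proof.
change (pwl (enum 'I_g) (m + n) x = pwl (enum 'I_g) m (pwl (enum 'I_g) n x)).
elim: (enum 'I_g) => //= i l IH.
rewrite ffunE powZD IH; congr (pw _ _ _); apply: powZ_commute => y.
exact: pwl_commute.
Qed.

Hypotheses (hT : forall i, continuous (T i)) (hTinv : forall i, continuous (Tinv i)).

Lemma continuous_iter (h : X -> X) n : continuous h -> continuous (iter n h).
Proof.
move=> ch; elim: n => [|n IH] x /=; first exact: cvg_id.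
by apply: continuous_comp; [exact: IH | exact: ch].
Qed.

Lemma continuous_Tpow n : continuous (Tpow T Tinv n).
Proof.
rewrite /Tpow; elim: (enum 'I_g) => [|i l IH] x /=; first exact: cvg_id.
apply: continuous_comp; first exact: IH.
by case: (n i) => k; exact: continuous_iter.
Qed.

(** Being in the closure makes the preimages of neighbourhoods of [w] under the orbit map a base of
    a proper filter, which is then refined. A filter replaces a sequence since [X] is an arbitrary
    topological space. *)
Lemma orbit_ultrafilter w0 w : closure (range (fun n => Tpow T Tinv n w0)) w ->
  exists U : set_system (site g), UltraFilter U /\ Tpow T Tinv n w0 @[n --> U] --> w.
Proof.
move=> cw.
pose F : set_system (site g) :=
  filter_from (nbhs w) (fun A => (fun n => Tpow T Tinv n w0) @^-1` A).
have FF : ProperFilter F.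
  apply: filter_from_proper.
    apply: filter_from_filter; first by exists setT; exact: filterT.
    by move=> A B wA wB; exists (A `&` B) => //; exact: filterI.
  by move=> A /cw [_ [[n _ <-] An]]; exists n.
have [U [UU FU]] := ultraFilterLemma FF.
by exists U; split=> // A wA; apply: FU; exists A.
Qed.

End Dynamics.

Theorem theorem1p1 (g : nat) (X : topologicalType) (R : realType)
  (T Tinv : 'I_g -> X -> X)
  (hT : forall i, continuous (T i)) (hTinv : forall i, continuous (Tinv i))
  (hK1 : forall i, cancel (T i) (Tinv i)) (hK2 : forall i, cancel (Tinv i) (T i))
  (hcomm : forall i j, T i \o T j = T j \o T i)
  (hmin : minimal_action T Tinv)
  (f : X -> R) (hf : continuous f)
  (hone : exists w0 : X, ULE (Hop T Tinv f w0)) :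
  exists a C : R, 0 < a /\ 0 < C /\
    forall w : X, ULE_with (Hop T Tinv f w) a C.
Proof.
have [w0 [a [C [a0 [C0 ule]]]]] := hone.
exists a, C; split=> //; split=> // w.
pose V (v : X) (m : site g) := f (Tpow T Tinv m v).
have [K [S [psi fr]]] : exists K S psi, @localized_frame g R (V w0) K a C S psi.
  exact: ULE_frame.
have wcl : closure (range (fun n => Tpow T Tinv n w0)) w by rewrite hmin.
have [U [UU Uw]] := orbit_ultrafilter wcl.
(* By the group law the translated potential at [m] is [f] composed with the [m]-th power of the
   action, evaluated along the orbit; continuity gives its limit for each fixed [m]. *)
have Vcvg m : V w0 (m + n) @[n --> U] --> V w m.
  rewrite /V; under eq_fun do rewrite (TpowD hK1 hK2 hcomm).
  have cV : {for w, continuous (fun v => f (Tpow T Tinv m v))}.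
    apply: continuous_comp; last exact: hf.
    exact: (continuous_Tpow hT hTinv).
  exact: cvg_comp Uw cV.
have [psi' fr'] := frame_ultralimit UU a0 (ltW C0) (fun n => frame_translate n fr) Vcvg.
exact: frame_ULE a0 fr'.
Qed.
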